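(* Any composition of the difference operators $\delta_{j,K}^\pm$ and of multiplication operators $B_{V,K}$, with $V$ smooth periodic functions, acting on $u\in\ell^2(\mathbb{Z}_K^d)$, defines a discrete pseudo-differential operator acting on the discrete Fourier transform $\hat u=\mathcal{F}_Ku$. More precisely, let $P\in\mathbb{N}$ and, for $p=1,\dots,P$, let $V_p:\mathbb{T}^d\to\mathbb{C}$ be smooth functions, $\epsilon_p\in\{0,+,-\}$ and $j_p\in\{1,\dots,d\}$. For all $K\in2\mathbb{N}^*$ define $$A^K=\prod_{p=1}^PM_{V_p,K}\,D^{\epsilon_p}_{j_p,K},$$ with the convention $D^0_{j,K}=\mathrm{Id}_K$. Then the family $A^\bullet=\{A^K\}_{K\in2\mathbb{N}^*}$ belongs to $\mathcal{A}_r^{\rm per}$ with $r=\sum_{p=1}^P|\epsilon_p|$, where $|0|=0$ and $|\pm|=1$.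
   Context: $d\geq1$ is a fixed integer, $\mathbb{N}=\{0,1,\dots\}$, $2\mathbb{N}^*$ is the set of positive even integers, $\mathbb{T}^d=(\mathbb{R}/2\pi\mathbb{Z})^d$. For $K\in2\mathbb{N}^*$, $h=2\pi/K$, $\mathbb{Z}_K^d=(\mathbb{Z}/K\mathbb{Z})^d$, $\ell^2(\mathbb{Z}_K^d)=\mathbb{C}^{\mathbb{Z}_K^d}$; for $a\in\mathbb{Z}_K^d$ with representative $\hat a\in\{-K/2,\dots,K/2-1\}^d$, $[a]=|\hat a_1|+\cdots+|\hat a_d|$. The discrete Fourier transform is $(\mathcal{F}_Kv)_a=K^{-d}\sum_{b\in\mathbb{Z}_K^d}e^{-2i\pi a\cdot b/K}v_b$. With $e_j$ the $j$-th basis vector: $(\delta_{j,K}^+u)_a=(u_{a+e_j}-u_a)/h$, $(\delta_{j,K}^-u)_a=(u_a-u_{a-e_j})/h$, and $(B_{V,K}u)_a=V(ah)u_a$. Their Fourier representations are $D^\pm_{j,K}=\mathcal{F}_K\delta^\pm_{j,K}\mathcal{F}_K^{-1}$, the diagonal matrices with entries $\frac1h(e^{iha_j}-1)$ for $D^+_{j,K}$ and $\frac1h(1-e^{-iha_j})$ for $D^-_{j,K}$, $a\in\mathbb{Z}_K^d$; and $M_{V,K}=\mathcal{F}_KB_{V,K}\mathcal{F}_K^{-1}$, with entries $M_{V,K}(a,b)=\sum_{\ell\in\mathbb{Z}^d}(\mathcal{F}V)_{a-b+\ell K}$, where $(\mathcal{F}V)_k=(2\pi)^{-d}\int_{\mathbb{T}^d}e^{-ik\cdot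 x}V(x)\,\mathrm{d}x$. For matrices $A^K:\mathbb{Z}_K^d\times\mathbb{Z}_K^d\to\mathbb{C}$, $(\Delta_j^\pm A^K)(m,n)=A^K(m\pm e_j,n\pm e_j)-A^K(m,n)$ (indices modulo $K$); for $a\in\mathbb{Z}$, $\Delta_j^a=(\Delta_j^+)^a$ if $a\geq0$, $(\Delta_j^-)^{|a|}$ if $a\leq0$; $\Delta^\alpha=\Delta_1^{\alpha_1}\cdots\Delta_d^{\alpha_d}$ and $|\alpha|=\sum_j|\alpha_j|$ for $\alpha\in\mathbb{Z}^d$. A family $\{A^K\}_{K\in2\mathbb{N}^*}$ belongs to $\mathcal{A}^{\rm per}_r$ if for all $\alpha\in\mathbb{Z}^d$, $N\in\mathbb{N}$ there is $C_{N,\alpha}>0$, independent of $K$, such that $|(\Delta^\alpha A^K)(m,n)|\leq C_{N,\alpha}(1+[m]+[n])^{r-|\alpha|}(1+[m-n])^{-N}$ for all $K\in2\mathbb{N}^*$, $m,n\in\mathbb{Z}_K^d$. *)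

(* Defs.v *)
From HB Require Import structures.
From mathcomp Require Import all_boot all_order all_algebra.
From mathcomp Require Import all_classical all_reals all_analysis.
From mathcomp Require Import complex ring lra.
Import Order.TTheory GRing.Theory Num.Theory numFieldNormedType.Exports.

Set Implicit Arguments.
Unset Strict Implicit.
Unset Printing Implicit Defensive.

Local Open Scope ring_scope.
Local Open Scope complex_scope.

(** * Smooth functions on the torus *)

Definition unit_vec (S : nzSemiRingType) (d : nat) (j : 'I_d) : 'rV[S]_d :=
  delta_mx 0 j.

Section Smooth.
Variables (R : realType) (d : nat).

Definition iter_partial (s : seq 'I_d) (f : 'rV[R]_d -> R) : 'rV[R]_d -> R :=
  foldr (fun j g => fun x => 'D_(unit_vec R j) g x) f s.

(* 'D_v g x is a junk value when the limit does not exist, hence the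
   explicit [derivable] clause at every stage. *)
Definition smooth (f : 'rV[R]_d -> R) : Prop :=
  forall s : seq 'I_d,
    continuous (iter_partial s f) /\
    forall (j : 'I_d) (x : 'rV[R]_d), derivable (iter_partial s f) x (unit_vec R j).

(* A function on (R / 2 pi Z)^d is a function on R^d that is 2 pi-periodic in
   each variable.  R[i] is a normed module over itself but not over R, so
   smoothness is required of the real and imaginary parts. *)
Definition smooth_on_torus (V : 'rV[R]_d -> R[i]) : Prop :=
  [/\ forall j : 'I_d, periodic V ((2 * pi) *: unit_vec R j),
      smooth (fun x => complex.Re (V x))
    & smooth (fun x => complex.Im (V x))].

End Smooth.

(** * The discrete torus (Z / K Z)^d *)

(* 'Z_K is Z / K Z as soon as 1 < K; everything below is only used for
   positive even K. *)
Notation grid K d := 'rV['Z_K]_d.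

Section Bracket.
Variables (K d : nat).

(* the representative in {-K/2, ..., K/2 - 1} *)
Definition crep (x : 'Z_K) : int :=
  if (x < K./2)%N then x%:Z else x%:Z - K%:Z.

Definition bracket (a : grid K d) : nat := (\sum_(j < d) `|crep (a 0%R j)|)%N.

Definition dotp (a b : grid K d) : 'Z_K := \sum_(j < d) a 0 j * b 0 j.

End Bracket.

Inductive dsign := DZero | DPlus | DMinus.

Definition dsign_abs (e : dsign) : nat := if e is DZero then 0%N else 1%N.

Section Operators.
Variables (R : realType) (d K : nat).

Definition cis (t : R) : R[i] := cos t +i* sin t.

Definition mesh : R := 2 * pi / K%:R.

(* exp(2 i pi x / K), evaluated at the representative of x in {0, ..., K - 1};
   the value does not depend on that choice. *)
Definition chi (x : 'Z_K) : R[i] := cis (2 * pi * (x : nat)%:R / K%:R).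

Definition dft (v : grid K d -> R[i]) : grid K d -> R[i] :=
  fun a => (K%:R ^+ d)^-1 * \sum_(b : grid K d) chi (- dotp a b) * v b.

(* The inverse of [dft]: see [idftK] and [dftK] below. *)
Definition idft (v : grid K d -> R[i]) : grid K d -> R[i] :=
  fun a => \sum_(b : grid K d) chi (dotp a b) * v b.

Definition delta_op (e : dsign) (j : 'I_d) (u : grid K d -> R[i]) :
    grid K d -> R[i] :=
  match e with
  | DZero => u
  | DPlus => fun a => (u (a + unit_vec _ j) - u a) / mesh%:C
  | DMinus => fun a => (u a - u (a - unit_vec _ j)) / mesh%:C
  end.

(* For V periodic, V (a h) does not depend on the representative of a. *)
Definition grid_point (a : grid K d) : 'rV[R]_d :=
  \row_(j < d) ((a 0 j : nat)%:R * mesh).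

Definition mult_op (V : 'rV[R]_d -> R[i]) (u : grid K d -> R[i]) :
    grid K d -> R[i] :=
  fun a => V (grid_point a) * u a.

Definition gridmx := grid K d -> grid K d -> R[i].

Definition gmx_id : gridmx := fun m n => (m == n)%:R.

Definition gmx_mul (A B : gridmx) : gridmx :=
  fun m n => \sum_(k : grid K d) A m k * B k n.

Definition gmx_apply (A : gridmx) (v : grid K d -> R[i]) : grid K d -> R[i] :=
  fun m => \sum_(n : grid K d) A m n * v n.

(* The matrix of F_K T F_K^-1, read off on the canonical basis. *)
Definition fourier_mx (T : (grid K d -> R[i]) -> grid K d -> R[i]) : gridmx :=
  fun m n => dft (T (idft (fun k => (k == n)%:R))) m.

Definition Dmx (e : dsign) (j : 'I_d) : gridmx :=
  if e is DZero then gmx_id else fourier_mx (delta_op e j).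

Definition Mmx (V : 'rV[R]_d -> R[i]) : gridmx := fourier_mx (mult_op V).

(* Delta_j^+ is [mx_shift_diff (unit_vec _ j)], Delta_j^- is
   [mx_shift_diff (- unit_vec _ j)]. *)
Definition mx_shift_diff (s : grid K d) (A : gridmx) : gridmx :=
  fun m n => A (m + s) (n + s) - A m n.

Definition mx_diff1 (j : 'I_d) (a : int) : gridmx -> gridmx :=
  match a with
  | Posz k => iter k (mx_shift_diff (unit_vec _ j))
  | Negz k => iter k.+1 (mx_shift_diff (- unit_vec _ j))
  end.

Definition mx_diff (alpha : 'I_d -> int) : gridmx -> gridmx :=
  \big[(fun f g => f \o g)/id]_(j < d) mx_diff1 j (alpha j).

End Operators.

Definition normi (d : nat) (alpha : 'I_d -> int) : nat :=
  (\sum_(j < d) `|alpha j|)%N.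

(* The comparison takes place in R[i], where `|z| is the modulus of z. *)
Definition Aper (R : realType) (d : nat) (r : R)
    (A : forall K : nat, gridmx R d K) : Prop :=
  forall (alpha : 'I_d -> int) (N : nat), exists C : R, 0 < C /\
    forall K : nat, (0 < K)%N -> ~~ odd K ->
    forall m n : grid K d,
      `|mx_diff alpha (A K) m n| <=
        (C * (1 + (bracket m)%:R + (bracket n)%:R) `^ (r - (normi alpha)%:R)
           * (1 + (bracket (m - n))%:R) ^- N)%:C.

Section Inversion.
Variables (R : realType) (d K : nat).
Hypothesis K_gt1 : (1 < K)%N.
Notation chi := (@chi R K).

Lemma cisD (s t : R) : cis (s + t) = cis s * cis t.
Proof.
rewrite /cis cosD sinD; apply/eqP; rewrite eq_complex /=.
by rewrite addrC eqxx addrC eqxx.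
Qed.

Lemma cis_turns (n : nat) (t : R) : cis (t + pi *+ 2 *+ n) = cis t.
Proof.
by rewrite /cis (periodicn (@cosD2pi R)) (periodicn (@sinD2pi R)).
Qed.

Lemma chi0 : chi 0 = 1.
Proof. by rewrite /Defs.chi /= mulr0 mul0r /cis cos0 sin0. Qed.

Lemma chi_modn (n : nat) : cis (2 * pi * n%:R / K%:R : R) = chi (n%:R).
Proof.
have K0 : K%:R != 0 :> R by rewrite pnatr_eq0 -lt0n ltnW.
rewrite /Defs.chi val_Zp_nat // -[RHS](cis_turns (n %/ K)); congr cis.
rewrite {1}(divn_eq n K) natrD natrM -(mulr_natr _ (n %/ K)).
by field.
Qed.

Lemma chiD (x y : 'Z_K) : chi (x + y) = chi x * chi y.
Proof.
rewrite -[x]natr_Zp -[y]natr_Zp -natrD -!chi_modn -cisD natrD.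
by rewrite mulrDr mulrDl.
Qed.

Lemma chi_eq1 (x : 'Z_K) : chi x = 1 -> x = 0.
Proof.
have K0 : 0 < K%:R :> R by rewrite ltr0n ltnW.
move=> /(congr1 (@complex.Re R)) /=; apply: contra_eq => x0.
have x_gt0 : (0 < x)%N by rewrite lt0n.
have x_ltK : (x < K)%N by have := ltn_ord x; rewrite [X in (_ < X)%N]Zp_cast.
pose t : R := pi * (x : nat)%:R / K%:R.
have -> : 2 * pi * (x : nat)%:R / K%:R = t *+ 2.
  by rewrite /t; ring.
have : 0 < sin t.
  apply: sin_gt0_pi; rewrite /t divr_gt0 ?mulr_gt0 ?pi_gt0 ?ltr0n //=; last exact: ltnW.
  by rewrite ltr_pdivrMr // ltr_pM2l ?pi_gt0 // ltr_nat.
rewrite cos_mulr2n cos2sin2 => s0; rewrite lt_eqF //.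
have := exprn_gt0 2 s0; lra.
Qed.

Lemma dotpDr (a b c : grid K d) : dotp a (b + c) = dotp a b + dotp a c.
Proof. by rewrite /dotp -big_split; apply: eq_bigr => j _; rewrite mxE mulrDr. Qed.

Lemma dotpC (a b : grid K d) : dotp a b = dotp b a.
Proof. by apply: eq_bigr => j _; rewrite mulrC. Qed.

Lemma dotpNr (a b : grid K d) : dotp a (- b) = - dotp a b.
Proof. by rewrite /dotp -sumrN; apply: eq_bigr => j _; rewrite mxE mulrN. Qed.

Lemma dotp_basis (a : grid K d) (j : 'I_d) : dotp a (unit_vec _ j) = a 0 j.
Proof.
rewrite /dotp (bigD1 j) //= !mxE !eqxx mulr1 big1 ?addr0 // => i ij.
by rewrite !mxE (negPf ij) andbF mulr0.
Qed.

Lemma card_grid : #|{: grid K d}| = (K ^ d)%N.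
Proof. by rewrite card_mx card_ord Zp_cast // mul1n. Qed.

Lemma sum_chi (a : grid K d) :
  \sum_(b : grid K d) chi (dotp a b) = (a == 0)%:R * K%:R ^+ d.
Proof.
have [->|a0] := eqVneq a 0.
  rewrite mul1r -natrX -card_grid -sumr_const; apply: eq_bigr => b _.
  by rewrite /dotp big1 ?chi0 // => j _; rewrite mxE mul0r.
have /existsP [j aj] : [exists j, a 0 j != 0].
  apply: contraNT a0; rewrite negb_exists => /forallP a0.
  by apply/eqP/rowP => j; rewrite mxE; apply/eqP; have := a0 j; rewrite negbK.
rewrite mul0r; set S := LHS.
have : S = chi (a 0 j) * S.
  rewrite {1}/S (reindex_inj (addIr (unit_vec _ j))) mulr_sumr.
  by apply: eq_bigr => b _; rewrite dotpDr dotp_basis addrC chiD.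
move/eqP; rewrite -subr_eq0 -{1}[S]mul1r -mulrBl mulf_eq0 subr_eq0.
by case/orP => /eqP // /esym /chi_eq1 aj0; rewrite aj0 eqxx in aj.
Qed.

Lemma Kd_neq0 : K%:R ^+ d != 0 :> R[i].
Proof. by rewrite expf_neq0 // pnatr_eq0 -lt0n ltnW. Qed.

Lemma sum_chi_chi (a c : grid K d) :
  \sum_(b : grid K d) chi (dotp a b) * chi (- dotp b c)
    = (a == c)%:R * K%:R ^+ d.
Proof.
rewrite -subr_eq0 -sum_chi; apply: eq_bigr => b _.
by rewrite -chiD dotpC -dotpNr -dotpDr dotpC.
Qed.

Lemma sum_delta (v : grid K d -> R[i]) (a : grid K d) :
  \sum_(c : grid K d) (a == c)%:R * v c = v a.
Proof.
rewrite (bigD1 a) //= eqxx mul1r big1 ?addr0 // => c ca.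
by rewrite eq_sym (negPf ca) mul0r.
Qed.

Lemma dftK (v : grid K d -> R[i]) (a : grid K d) : idft (dft v) a = v a.
Proof.
apply: (mulIf Kd_neq0); rewrite -[v a]sum_delta /idft /dft mulr_suml.
under eq_bigr => b _ do rewrite mulrCA mulrC mulVKf ?Kd_neq0 // mulr_sumr.
rewrite exchange_big mulr_suml; apply: eq_bigr => c _ /=.
under eq_bigr => b _ do rewrite mulrA.
by rewrite -mulr_suml sum_chi_chi mulrAC.
Qed.

Lemma idftK (v : grid K d -> R[i]) (a : grid K d) : dft (idft v) a = v a.
Proof.
apply: (mulfI Kd_neq0); rewrite -[v a]sum_delta /idft /dft mulVKf ?Kd_neq0 //.
under eq_bigr => b _ do rewrite mulr_sumr.
rewrite exchange_big mulr_sumr; apply: eq_bigr => c _ /=.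
under eq_bigr => b _ do rewrite (dotpC a b) (dotpC b c) mulrA (mulrC (chi _)).
by rewrite -mulr_suml sum_chi_chi mulrCA mulrA eq_sym (mulrC _ (_ ^+ d)).
Qed.

Lemma idft_delta (n a : grid K d) :
  idft (fun k => (k == n)%:R) a = chi (dotp a n).
Proof.
rewrite /idft; under eq_bigr => b _ do rewrite eq_sym mulrC.
exact: sum_delta.
Qed.

Lemma dft_scaled_idft (c : R[i]) (v w : grid K d -> R[i]) (a : grid K d) :
  (forall b, w b = c * idft v b) -> dft w a = c * v a.
Proof.
move=> wE; rewrite -(idftK v) /dft [RHS]mulrCA; congr (_ * _).
by rewrite mulr_sumr; apply: eq_bigr => b _; rewrite wE mulrCA.
Qed.

Lemma chi_mesh (x : 'Z_K) : chi x = cis (mesh R K * (x : nat)%:R).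
Proof. by rewrite /Defs.chi /mesh mulrAC. Qed.

Lemma Dmx_plusE (j : 'I_d) (m n : grid K d) :
  Dmx R DPlus j m n =
    (cis (mesh R K * (n 0 j : nat)%:R) - 1) / (mesh R K)%:C * (m == n)%:R.
Proof.
apply: (dft_scaled_idft (v := fun k => (k == n)%:R)) => b.
rewrite /delta_op !idft_delta -chi_mesh.
rewrite dotpC dotpDr chiD dotp_basis dotpC mulrAC; congr (_ / _).
by rewrite mulrBl mul1r mulrC.
Qed.

Lemma Dmx_minusE (j : 'I_d) (m n : grid K d) :
  Dmx R DMinus j m n =
    (1 - cis (- (mesh R K * (n 0 j : nat)%:R))) / (mesh R K)%:C * (m == n)%:R.
Proof.
have -> : cis (- (mesh R K * (n 0 j : nat)%:R)) = chi (- n 0 j).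
  have chi_n0 : chi (n 0 j) != 0.
    apply/eqP => n0; have := chi0; rewrite -(subrr (n 0 j)) chiD n0 mul0r.
    by move/eqP; rewrite eq_sym oner_eq0.
  apply: (mulfI chi_n0); rewrite -chiD subrr chi0 chi_mesh -cisD subrr.
  by rewrite /cis cos0 sin0.
apply: (dft_scaled_idft (v := fun k => (k == n)%:R)) => b.
rewrite /delta_op !idft_delta.
rewrite (dotpC (b - _)) dotpDr dotpNr chiD dotp_basis (dotpC n) mulrAC.
by congr (_ / _); rewrite mulrBl mul1r mulrC.
Qed.

End Inversion.

(* Main.v *)
Require Import Defs.
From mathcomp Require Import all_boot all_order all_algebra.
From mathcomp Require Import all_classical all_reals all_analysis.
From mathcomp Require Import complex.
From mathcomp Require Import zify ring lra.
Import Order.TTheory GRing.Theory Num.Theory numFieldNormedType.Exports.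

(** The symbol classes form a graded algebra, and both kinds of factors lie in
    it: multiplications have order 0 and difference operators have order 1.

    The algebra property is [symbol_mul].  For a diagonal translation [D] of the
    indices one has the Leibniz rule [D(AB) = (D A) B + A (D B) + (D A) (D B)],
    which reduces differences of a product to undifferentiated products of
    matrices of lower order.  For those ([decay_order_mul]) the weight
    [1 + [m] + [k]] is exchanged for [1 + [m] + [n]] at the price of a power of
    [1 + [k - n]] (Peetre's inequality), which the off-diagonal decay absorbs;
    the sum over the intermediate index [k] then converges uniformly in [K]
    ([sum_bracket_le]).

    A difference operator is a diagonal matrix with entries [(chi x - 1) / h].
    The first difference of such a matrix is a multiple [c chi x] of a character
    with [c] bounded, and each further difference multiplies [c] by
    [chi (+-1) - 1 = O(h)].  As [1 + 2 [m] = O(1 / h)] on the grid, every power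
    of [h] is as good as one negative power of the weight ([symbol_chi_diag]).

    The matrix of the multiplication by [V] is Toeplitz modulo [K], so its
    differences vanish, and only its off-diagonal decay is at stake.  Its entries
    are discrete Fourier coefficients of the samples of [V].  Rather than summing
    the aliased continuous Fourier coefficients, the proof sums by parts on the
    grid: [((chi a_j - 1) / h) ^ N] times the coefficient at [a] is the coefficient
    of the [N]-th difference quotient of the samples.  The latter is bounded by the
    maximum of the [N]-th partial derivative through the mean value theorem, while
    [|chi a_j - 1| / h] is at least half the absolute value of the representative
    of [a_j] ([dft_sample_decay]).

    The conjugation identity only uses that the discrete Fourier transform is
    invertible and that the operators are linear ([represents_fourier_mx]). *)

Set Implicit Arguments.
Unset Strict Implicit.
Unset Printing Implicit Defensive.

Local Open Scope ring_scope.
Local Open Scope complex_scope.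

Import Normc.

(** * The bracket on the discrete torus *)

Lemma even_gt1 (K : nat) : (0 < K)%N -> ~~ odd K -> (1 < K)%N.
Proof. by case: K => [|[]]. Qed.

Lemma ltn_Zp (K : nat) (x : 'Z_K) : (1 < K)%N -> (x < K)%N.
Proof. by move=> K1; have := ltn_ord x; rewrite [X in (_ < X)%N]Zp_cast. Qed.

Lemma val_ZpD (K : nat) (x y : 'Z_K) : (1 < K)%N ->
  (x + y)%R = ((x + y) %% K)%N :> nat.
Proof. by case: K x y => [|[|K]]. Qed.

Lemma val_ZpN (K : nat) (x : 'Z_K) : (1 < K)%N ->
  (- x)%R = ((K - x) %% K)%N :> nat.
Proof. by case: K x => [|[|K]]. Qed.

(** For even [K] the centred representative has the least absolute value in its
    class; the triangle inequality for the bracket rests on this form. *)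
Lemma absz_crep (K : nat) (x : 'Z_K) : (0 < K)%N -> ~~ odd K ->
  `|crep x|%N = minn x (K - x).
Proof.
move=> K0 Ke; have := ltn_Zp x (even_gt1 K0 Ke).
have := even_halfK Ke; rewrite /crep -muln2.
by move: (nat_of_ord x) (K./2) => v k; case: (ltnP v k) => vk; lia.
Qed.

Lemma absz_crepD (K : nat) (x y : 'Z_K) : (0 < K)%N -> ~~ odd K ->
  (`|crep (x + y)%R| <= `|crep x| + `|crep y|)%N.
Proof.
move=> K0 Ke; have K1 := even_gt1 K0 Ke.
rewrite !absz_crep // val_ZpD //; have := ltn_Zp x K1; have := ltn_Zp y K1.
move: (nat_of_ord x) (nat_of_ord y) => v w wK vK.
case: (ltnP (v + w) K) => vw; first by rewrite modn_small //; lia.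
have -> : ((v + w) %% K = v + w - K)%N.
  by rewrite -{1}(subnK vw) modnDr modn_small //; lia.
lia.
Qed.

Lemma absz_crepN (K : nat) (x : 'Z_K) : (0 < K)%N -> ~~ odd K ->
  `|crep (- x)%R|%N = `|crep x|%N.
Proof.
move=> K0 Ke; have K1 := even_gt1 K0 Ke.
rewrite !absz_crep // val_ZpN //; have := ltn_Zp x K1.
move: (nat_of_ord x) => [|v] vK; first by rewrite subn0 modnn; lia.
by rewrite modn_small; lia.
Qed.

Lemma absz_crep_le (K : nat) (x : 'Z_K) : (0 < K)%N -> ~~ odd K ->
  (`|crep x| <= K./2)%N.
Proof.
move=> K0 Ke; rewrite absz_crep //; have := ltn_Zp x (even_gt1 K0 Ke).
by have := even_halfK Ke; rewrite -muln2; lia.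
Qed.

Section Bracket.
Variables (K d : nat).
Hypotheses (K0 : (0 < K)%N) (Ke : ~~ odd K).

Lemma bracketD (a b : grid K d) : (bracket (a + b)%R <= bracket a + bracket b)%N.
Proof.
rewrite /bracket -big_split /=; apply: leq_sum => i _.
by rewrite mxE; apply: absz_crepD.
Qed.

Lemma bracketN (a : grid K d) : bracket (- a) = bracket a.
Proof. by apply: eq_bigr => i _; rewrite mxE absz_crepN. Qed.

Lemma bracketB (a b : grid K d) : bracket (a - b) = bracket (b - a).
Proof. by rewrite -bracketN opprB. Qed.

Lemma bracket_le (a : grid K d) : (bracket a <= d * K./2)%N.
Proof.
rewrite /bracket -[X in (X * _)%N]card_ord -sum_nat_const.
by apply: leq_sum => i _; apply: absz_crep_le.
Qed.

Lemma crep_le_bracket (a : grid K d) (j : 'I_d) :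
  (`|crep (a 0%R j)| <= bracket a)%N.
Proof. by rewrite /bracket (bigD1 j) //= leq_addr. Qed.

(** Comparing the bracket with its largest coordinate turns decay in each
    coordinate separately into decay in the bracket. *)
Lemma bracket_max (a : grid K d) : (0 < d)%N ->
  exists j, (bracket a <= d * `|crep (a 0%R j)|)%N.
Proof.
move=> d0; have [j _ jm] := @arg_maxnP _ (Ordinal d0) xpredT
  (fun j => `|crep (a 0%R j)|%N) isT.
exists j; rewrite /bracket -[X in (X * _)%N]card_ord -sum_nat_const.
by apply: leq_sum => i _; apply: jm.
Qed.

End Bracket.

Section Summability.
Variable R : realType.

(** The induction proves the telescoping bound [2 - 1 / n]. *)
Lemma sum_inv_sqr_le2 (n : nat) : \sum_(i < n) (1 + i%:R : R) ^- 2 <= 2.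
Proof.
suff H : \sum_(i < n.+1) (1 + i%:R : R) ^- 2 <= 2 - (n.+1)%:R^-1.
  case: n H => [|n] H; first by rewrite big_ord0.
  apply: le_trans (_ : \sum_(i < n.+2) (1 + i%:R : R) ^- 2 <= _).
    by rewrite [leRHS]big_ord_recr /= lerDl invr_ge0 exprn_ge0.
  by apply: le_trans H _; rewrite gerBl invr_ge0.
elim: n => [|n IH].
  by rewrite big_ord_recr big_ord0 /= add0r addr0 expr1n invr1; lra.
rewrite big_ord_recr /=; apply: le_trans (lerD IH (lexx _)) _.
have -> : (1 + n.+1%:R : R) = n.+2%:R by rewrite addrC natr1.
set x : R := n.+1%:R; have x0 : 0 < x by rewrite ltr0n.
have -> : n.+2%:R = x + 1 :> R by rewrite natr1.
rewrite -addrA lerD2l -subr_ge0.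
have -> : - (x + 1)^-1 - (- x^-1 + (x + 1) ^- 2) = (x * (x + 1) ^+ 2)^-1.
  by field; rewrite !gt_eqF //; lra.
by rewrite invr_ge0 mulr_ge0 ?exprn_ge0; lra.
Qed.

(** The absolute value of the representative is [x] or [K - x], so each term is
    dominated by the sum of the corresponding terms of [1 / (1 + i) ^ 2] counted
    from either end of the range. *)
Lemma sum_crep_le4 (K : nat) : (0 < K)%N -> ~~ odd K ->
  \sum_(x : 'Z_K) (1 + `|crep x|%N%:R : R) ^- 2 <= 4.
Proof.
move=> K0 Ke; have K1 := even_gt1 K0 Ke.
have Kc : (Zp_trunc K).+2 = K by apply: Zp_cast.
apply: (@le_trans _ _ (\sum_(x : 'Z_K) ((1 + (x : nat)%:R : R) ^- 2 +
    (1 + (rev_ord x : nat)%:R) ^- 2))).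
  apply: ler_sum => x _; rewrite absz_crep //.
  have nn (k : nat) : 0 <= (1 + k%:R : R) ^- 2 by rewrite invr_ge0 exprn_ge0.
  have [le|lt] := leqP x (K - x).
    by rewrite lerDl.
  rewrite -[leLHS]add0r lerD //.
  rewrite lef_pV2 ?posrE ?exprn_gt0 ?ltr_wpDr ?ltr01 //.
  rewrite lerXn2r ?nnegrE ?addr_ge0 // lerD2l ler_nat /=.
  by move: Kc; clear; lia.
rewrite big_split /= -(reindex_inj rev_ord_inj (op := +%R) (P := xpredT)
  (F := fun x : 'Z_K => (1 + (x : nat)%:R : R) ^- 2)) /=.
by have := sum_inv_sqr_le2 (Zp_trunc K).+2; lra.
Qed.

Lemma sum_rV_prod (T : finType) (d : nat) (F : 'I_d -> T -> R) :
  \sum_(a : 'rV[T]_d) \prod_(j < d) F j (a 0%R j) = \prod_(j < d) \sum_(x : T) F j x.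
Proof.
rewrite bigA_distr_bigA /=.
rewrite (reindex (fun f : {ffun 'I_d -> T} => \row_j f j)) /=.
  by apply: eq_bigr => f _; apply: eq_bigr => i _; rewrite mxE.
exists (fun a : 'rV[T]_d => [ffun j => a 0%R j]) => [f _|a _].
  by apply/ffunP => j; rewrite ffunE mxE.
by apply/rowP => j; rewrite mxE ffunE.
Qed.

(** The exponent [2 d] is chosen so that the summand is dominated by the product
    over the coordinates of [1 / (1 + |a_j|) ^ 2], whose sum factorizes. *)
Lemma sum_bracket_le (K d : nat) : (0 < K)%N -> ~~ odd K ->
  \sum_(a : grid K d) (1 + (bracket a)%:R : R) ^- (2 * d) <= 4 ^+ d.
Proof.
move=> K0 Ke.
apply: (@le_trans _ _ (\sum_(a : grid K d)
   \prod_(j < d) (1 + `|crep (a 0%R j)|%N%:R : R) ^- 2)).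
  apply: ler_sum => a _.
  have -> : (1 + (bracket a)%:R : R) ^- (2 * d)
      = \prod_(j < d) (1 + (bracket a)%:R) ^- 2.
    by rewrite prodr_const card_ord exprVn exprM.
  apply: ler_prod => j _.
  rewrite invr_ge0 exprn_ge0 //=.
  rewrite lef_pV2 ?posrE ?exprn_gt0 ?ltr_wpDr ?ltr01 //.
  by rewrite lerXn2r ?nnegrE ?addr_ge0 // lerD2l ler_nat crep_le_bracket.
rewrite (sum_rV_prod (fun _ x => (1 + `|crep x|%N%:R : R) ^- 2)).
have -> : (4 : R) ^+ d = \prod_(j < d) 4 by rewrite prodr_const card_ord.
apply: ler_prod => j _.
rewrite sum_crep_le4 // andbT; apply: sumr_ge0 => x _.
by rewrite invr_ge0 exprn_ge0.
Qed.

End Summability.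

(** * Symbol classes and their products *)

Section Modulus.
Variable R : realType.

Lemma normCE (z : R[i]) : `|z| = (normc z)%:C.
Proof. by case: z. Qed.

Lemma normc_ge0 (z : R[i]) : 0 <= normc z.
Proof. by rewrite -lecR -normCE normr_ge0. Qed.

Lemma normc_real (x : R) : normc x%:C = `|x|.
Proof. by rewrite /= expr0n addr0 sqrtr_sqr. Qed.

Lemma normc_sum (I : finType) (F : I -> R[i]) :
  normc (\sum_i F i) <= \sum_i normc (F i).
Proof.
apply: (big_ind2 (fun x y => normc x <= y)) => //.
  by rewrite normc0.
by move=> x1 x2 y1 y2 h1 h2; apply: le_trans (le_normcD _ _) (lerD h1 h2).
Qed.

(** The two-sided comparison of [x] and [y] makes the bound available for either
    sign of the exponent. *)
Lemma powR_peetre (x y z r : R) (p : nat) : 1 <= x -> 1 <= y -> 1 <= z ->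
  x <= y * z -> y <= x * z -> `|r| <= p%:R -> x `^ r <= y `^ r * z ^+ p.
Proof.
move=> x1 y1 z1 xyz yxz rp.
have x0 : 0 < x by lra.
have y0 : 0 < y by lra.
have z0 : 0 < z by lra.
have aux (s u v : R) : 0 < u -> 0 < v -> u <= v * z -> 0 <= s -> s <= p%:R ->
    u `^ s <= v `^ s * z ^+ p.
  move=> u0 v0 uv s0 sp; apply: le_trans (_ : (v * z) `^ s <= _).
    by apply: ge0_ler_powR; rewrite ?nnegrE ?mulr_ge0 // ltW.
  rewrite powRM ?(ltW v0) ?(ltW z0) // ler_wpM2l ?powR_ge0 //.
  rewrite -(powR_mulrn _ (ltW z0)).
  exact: ler_powR.
have [r0|r0] := leP 0 r; first by apply: aux; rewrite // -(ger0_norm r0).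
have -> : r = - (- r) by rewrite opprK.
rewrite !(powRN _ (- r)) mulrC ler_pdivlMr ?powR_gt0 // mulrC.
rewrite ler_pdivrMr ?powR_gt0 // mulrC; apply: aux => //; first lra.
by rewrite -(ltr0_norm r0).
Qed.

End Modulus.

Section SymbolClasses.
Variables (R : realType) (d : nat).

Definition wt (K : nat) (m n : grid K d) : R :=
  1 + (bracket m)%:R + (bracket n)%:R.

(** The Japanese bracket. *)
Definition jap (K : nat) (m : grid K d) : R := 1 + (bracket m)%:R.

Definition decay_order (r : R) (A : forall K : nat, gridmx R d K) : Prop :=
  forall N : nat, exists2 C : R, 0 < C &
    forall K : nat, (0 < K)%N -> ~~ odd K -> forall m n : grid K d,
      normc (A K m n) <= C * wt m n `^ r * jap (m - n) ^- N.

(** The pair [(b, j)] encodes the direction [e_j] when [b] holds and [- e_j]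
    otherwise, so that all elementary differences are treated at once. *)
Definition signed_unit (K : nat) (e : bool * 'I_d) : grid K d :=
  if e.1 then unit_vec _ e.2 else - unit_vec _ e.2.

Definition step_diff (e : bool * 'I_d) (A : forall K : nat, gridmx R d K) :
    forall K : nat, gridmx R d K :=
  fun K => mx_shift_diff (signed_unit K e) (A K).

(** Estimates for at most [k] successive differences, in any order and in any
    directions.  The recursion on [k] is the one along which the Leibniz rule is
    applied. *)
Fixpoint symbol (k : nat) (r : R) (A : forall K : nat, gridmx R d K) : Prop :=
  decay_order r A /\
  if k is k'.+1 then forall e, symbol k' (r - 1) (step_diff e A) else True.

Lemma symbol_decay k r A : symbol k r A -> decay_order r A.
Proof. by case: k => [|k] []. Qed.

Lemma wt_ge1 (K : nat) (m n : grid K d) : 1 <= wt m n.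
Proof. by rewrite /wt -addrA lerDl addr_ge0. Qed.

Lemma wt_gt0 (K : nat) (m n : grid K d) : 0 < wt m n.
Proof. exact: lt_le_trans ltr01 (wt_ge1 m n). Qed.

Lemma jap_ge1 (K : nat) (m : grid K d) : 1 <= jap m.
Proof. by rewrite /jap lerDl. Qed.

Lemma jap_gt0 (K : nat) (m : grid K d) : 0 < jap m.
Proof. exact: lt_le_trans ltr01 (jap_ge1 m). Qed.

Lemma eq_symbol k r (A B : forall K : nat, gridmx R d K) :
  (forall K, (0 < K)%N -> ~~ odd K -> forall m n, A K m n = B K m n) ->
  symbol k r A -> symbol k r B.
Proof.
elim: k r A B => [|k IH] r A B eAB [dA sA]; split=> //;
  try by move=> N; have [C C0 hC] := dA N; exists C => // K K0 Ke m n;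
    rewrite -eAB ?hC.
move=> e; apply: IH (sA e) => K K0 Ke m n.
by rewrite /step_diff /mx_shift_diff !eAB.
Qed.

Lemma decay_order_le r r' A : r <= r' -> decay_order r A -> decay_order r' A.
Proof.
move=> rr' dA N; have [C C0 hC] := dA N; exists C => // K K0 Ke m n.
apply: le_trans (hC K K0 Ke m n) _.
rewrite ler_wpM2r ?invr_ge0 ?exprn_ge0 ?(ltW (jap_gt0 _)) //.
by rewrite ler_wpM2l ?(ltW C0) // ler_powR // wt_ge1.
Qed.

Lemma symbol_le k r r' A : r <= r' -> symbol k r A -> symbol k r' A.
Proof.
elim: k r r' A => [|k IH] r r' A rr' [dA sA]; split=> //;
  try exact: decay_order_le dA.
by move=> e; apply: IH (sA e); rewrite lerD2r.
Qed.

Lemma symbol_pred k r A : symbol k.+1 r A -> symbol k r A.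
Proof.
elim: k r A => [|k IH] r A [dA sA]; split=> // e; exact: IH (sA e).
Qed.

(** Applied to complex conjugation up to sign, which exchanges the forward and
    backward difference operators. *)
Lemma symbol_map (f : R[i] -> R[i]) k r A :
  (forall x y, f (x - y) = f x - f y) -> (forall x, normc (f x) = normc x) ->
  symbol k r A -> symbol k r (fun K m n => f (A K m n)).
Proof.
move=> fB fN; elim: k r A => [|k IH] r A [dA sA]; split=> //;
  try by move=> N; have [C C0 hC] := dA N; exists C => // K K0 Ke m n;
    rewrite fN hC.
move=> e; apply: eq_symbol (IH _ _ (sA e)) => K _ _ m n.
by rewrite /step_diff /mx_shift_diff fB.
Qed.

Lemma symbol_add k r A B : symbol k r A -> symbol k r B ->
  symbol k r (fun K m n => A K m n + B K m n).
Proof.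
have decayD r' A' B' : decay_order r' A' -> decay_order r' B' ->
    decay_order r' (fun K m n => A' K m n + B' K m n).
  move=> dA dB N; have [C C0 hC] := dA N; have [D D0 hD] := dB N.
  exists (C + D) => [|K K0 Ke m n]; first exact: addr_gt0.
  apply: le_trans (le_normcD _ _) _.
  by rewrite !mulrDl lerD ?hC ?hD.
elim: k r A B => [|k IH] r A B [dA sA] [dB sB]; split=> //; try exact: decayD.
move=> e; apply: eq_symbol (IH _ _ _ (sA e) (sB e)) => K _ _ m n.
by rewrite /step_diff /mx_shift_diff opprD addrACA.
Qed.

Lemma wt_jap_r (K : nat) (m k n : grid K d) : (0 < K)%N -> ~~ odd K ->
  wt m k <= wt m n * jap (k - n).
Proof.
move=> K0 Ke; have := bracketD K0 Ke (k - n) n; rewrite subrK -(ler_nat R) natrD.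
rewrite /wt /jap; have := ler0n R (bracket m); have := ler0n R (bracket n).
by have := ler0n R (bracket (k - n)); nra.
Qed.

Lemma wtC (K : nat) (m n : grid K d) : wt m n = wt n m.
Proof. by rewrite /wt addrAC. Qed.

Lemma japB (K : nat) (m n : grid K d) : (0 < K)%N -> ~~ odd K ->
  jap (m - n) = jap (n - m).
Proof. by move=> K0 Ke; rewrite /jap bracketB. Qed.

Lemma jap_trans (K : nat) (m k n : grid K d) : (0 < K)%N -> ~~ odd K ->
  jap (m - n) <= jap (m - k) * jap (k - n).
Proof.
move=> K0 Ke; have := bracketD K0 Ke (m - k) (k - n).
rewrite addrA subrK -(ler_nat R) natrD /jap; have := ler0n R (bracket (m - k)).
by have := ler0n R (bracket (k - n)); nra.
Qed.

Lemma sum_jap_le (K : nat) (m : grid K d) : (0 < K)%N -> ~~ odd K ->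
  \sum_(k : grid K d) jap (m - k) ^- (2 * d) <= 4 ^+ d.
Proof.
move=> K0 Ke; rewrite -[leLHS](reindex_inj (@subrI _ m) (op := +%R)
  (P := xpredT) (F := fun k => jap k ^- (2 * d))) /=.
exact: sum_bracket_le.
Qed.

(** After exchanging the weights for [1 + [m] + [n]], powers of the decay of both
    factors are spent on three purposes: restoring the decay in [m - n], paying
    for the exchange of weights ([p] and [q]), and summing over [k] ([2 * d]). *)
Lemma decay_order_mul r s A B : decay_order r A -> decay_order s B ->
  decay_order (r + s) (fun K => gmx_mul (A K) (B K)).
Proof.
move=> dA dB N.
have [p rp] : exists p : nat, `|r| <= p%:R.
  by exists (Num.bound `|r|); rewrite ltW // archi_boundP.
have [q sq] : exists q : nat, `|s| <= q%:R.
  by exists (Num.bound `|s|); rewrite ltW // archi_boundP.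
have [M hMa hMb] : exists2 M, (q + N + 2 * d <= M)%N & (p + N <= M)%N.
  by exists (N + p + q + 2 * d)%N; lia.
have [C C0 hC] := dA M; have [D D0 hD] := dB M.
exists (C * D * 4 ^+ d) => [|K K0 Ke m n]; first by rewrite !mulr_gt0 ?exprn_gt0.
apply: le_trans (normc_sum _) _.
(* Up to the summable factor, [W] bounds every term of the product. *)
pose W := C * D * (wt m n `^ (r + s) * jap (m - n) ^- N).
have W0 : 0 <= W.
  by rewrite !mulr_ge0 ?(ltW C0) ?(ltW D0) ?powR_ge0 ?invr_ge0 ?exprn_ge0
    ?(ltW (jap_gt0 _)).
apply: (@le_trans _ _ (\sum_k W * jap (m - k) ^- (2 * d))); last first.
  rewrite -mulr_sumr; apply: le_trans (ler_wpM2l W0 (sum_jap_le m K0 Ke)) _.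
  by rewrite /W le_eqVlt; apply/orP; left; apply/eqP; ring.
apply: ler_sum => k _; rewrite normcM.
apply: le_trans (ler_pM (normc_ge0 _) (normc_ge0 _) (hC K K0 Ke m k)
  (hD K K0 Ke k n)) _.
have h1 : wt m k `^ r <= wt m n `^ r * jap (k - n) ^+ p.
  apply: powR_peetre; rewrite ?wt_ge1 ?jap_ge1 ?wt_jap_r //.
  by rewrite japB ?wt_jap_r.
have h2 : wt k n `^ s <= wt m n `^ s * jap (m - k) ^+ q.
  apply: powR_peetre; rewrite ?wt_ge1 ?jap_ge1 //.
    by rewrite japB // wtC (wtC m) wt_jap_r.
  by rewrite wtC (wtC k) wt_jap_r.
have h3 := jap_trans m k n K0 Ke.
rewrite /W powRD; last by rewrite (gt_eqF (wt_gt0 m n)) implybT.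
have a1 := jap_ge1 (m - k); have b1 := jap_ge1 (k - n).
have c1 := jap_ge1 (m - n).
move: (jap (m - k)) (jap (k - n)) (jap (m - n)) a1 b1 c1 h1 h2 h3 => a b c.
move=> a1 b1 c1 h1 h2 h3.
have a0 : 0 < a by lra.
have b0 : 0 < b by lra.
have c0 : 0 < c by lra.
(* [c <= a b] gives back the decay in [m - n]; [M] was chosen large enough for
   the remaining powers of [a] and [b]. *)
have key : b ^+ p * a ^+ q * (a ^- M * b ^- M) <= c ^- N * a ^- (2 * d).
  rewrite -!invfM ler_pdivrMr ?mulr_gt0 ?exprn_gt0 // [leRHS]mulrC.
  rewrite ler_pdivlMr ?mulr_gt0 ?exprn_gt0 //.
  apply: (@le_trans _ _ (b ^+ p * a ^+ q * ((a * b) ^+ N * a ^+ (2 * d)))).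
    rewrite ler_wpM2l ?mulr_ge0 ?exprn_ge0 ?(ltW a0) ?(ltW b0) //.
    rewrite ler_wpM2r ?exprn_ge0 ?(ltW a0) //.
    by rewrite lerXn2r ?nnegrE ?mulr_ge0 ?(ltW a0) ?(ltW b0) ?(ltW c0).
  have -> : b ^+ p * a ^+ q * ((a * b) ^+ N * a ^+ (2 * d))
      = a ^+ (q + N + 2 * d) * b ^+ (p + N).
    by rewrite exprMn !exprD; ring.
  by rewrite ler_pM ?exprn_ge0 ?(ltW a0) ?(ltW b0) // ler_weXn2l.
apply: (@le_trans _ _ (C * D * ((wt m n `^ r * b ^+ p) * (wt m n `^ s * a ^+ q))
   * (a ^- M * b ^- M))).
  have -> : C * wt m k `^ r * a ^- M * (D * wt k n `^ s * b ^- M) =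
    C * D * (wt m k `^ r * wt k n `^ s) * (a ^- M * b ^- M) by ring.
  rewrite ler_wpM2r ?mulr_ge0 ?invr_ge0 ?exprn_ge0 ?(ltW a0) ?(ltW b0) //.
  by rewrite ler_wpM2l ?mulr_ge0 ?(ltW C0) ?(ltW D0) // ler_pM ?powR_ge0.
have -> : C * D * ((wt m n `^ r * b ^+ p) * (wt m n `^ s * a ^+ q))
   * (a ^- M * b ^- M) = C * D * (wt m n `^ r * wt m n `^ s) *
     (b ^+ p * a ^+ q * (a ^- M * b ^- M)) by ring.
rewrite !mulrA -!(mulrA (C * D * wt m n `^ r * wt m n `^ s)).
rewrite ler_wpM2l ?mulr_ge0 ?(ltW C0) ?(ltW D0) ?powR_ge0 //.
by move: key; rewrite !mulrA.
Qed.

(** Induction on the number of differences through the Leibniz rule.  The term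
    with both factors differentiated has order [r + s - 2], which is better than
    the required [r + s - 1]. *)
Lemma symbol_mul k r s A B : symbol k r A -> symbol k s B ->
  symbol k (r + s) (fun K => gmx_mul (A K) (B K)).
Proof.
elim: k r s A B => [|k IH] r s A B sA sB; split=> //;
  try exact: decay_order_mul (symbol_decay sA) (symbol_decay sB).
move=> e.
have [[_ /(_ e) dA] [_ /(_ e) dB]] := (sA, sB).
have [pA pB] := (symbol_pred sA, symbol_pred sB).
have AdB := IH _ _ _ _ pA dB; have dAB := IH _ _ _ _ dA pB.
have dAdB := IH _ _ _ _ dA dB.
rewrite addrA in AdB; rewrite addrAC in dAB.
have {}dAdB := symbol_le (_ : r - 1 + (s - 1) <= r + s - 1) dAdB.
apply: eq_symbol (symbol_add (symbol_add AdB dAB) (dAdB _)); last by lra.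
move=> K _ _ m n; rewrite /step_diff /mx_shift_diff /gmx_mul.
rewrite [X in _ = X - _](reindex_inj (addIr (signed_unit K e))) /=.
rewrite -sumrB -!big_split /=; apply: eq_bigr => i _; ring.
Qed.

End SymbolClasses.

(** * Characters and difference operators *)

Section Characters.
Variable R : realType.

Lemma sin_mean_value (x : R) : 0 <= x ->
  exists2 c, c \in `[0, x] & sin x = x * cos c.
Proof.
move=> x0; have [|c cx] := @MVT_segment R sin cos 0 x x0 (fun y _ => is_derive_sin y).
  by apply: continuous_subspaceT => y; exact: continuous_sin.
by rewrite sin0 !subr0 mulrC => ->; exists c.
Qed.

Lemma le_norm_sin (x : R) : `|sin x| <= `|x|.
Proof.
wlog x0 : x / 0 <= x => [H|].
  have [x0|x0] := leP 0 x; first exact: H.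
  by have := H (- x); rewrite sinN !normrN; apply; lra.
have [c _ ->] := sin_mean_value x0.
by rewrite normrM ler_piMr ?normr_ge0 ?cos_max.
Qed.

(** For nonnegative [x], the doubling formula and the mean value theorem give
    [sin x = 2 sin (x / 2) cos (x / 2) = x cos c cos (x / 2)], where both cosines
    are at least [cos (pi / 4)] and [cos (pi / 4) ^ 2 = 1 / 2]. *)
Lemma sin_ge_half (x : R) : `|x| <= pi / 2 -> `|x| / 2 <= `|sin x|.
Proof.
wlog x0 : x / 0 <= x => [H|].
  have [x0|x0] := leP 0 x; first exact: H.
  by have := H (- x); rewrite sinN !normrN; apply; lra.
rewrite ger0_norm // => xpi.
have pi0 : 0 < pi :> R := pi_gt0 R.
pose q : R := cos (pi / 4).
have q2 : q ^+ 2 = 1 / 2.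
  have := @cos_mulr2n R (pi / 4).
  have -> : (pi / 4) *+ 2 = pi / 2 :> R by rewrite -mulr_natr; field.
  by rewrite cos_pihalf -/q -mulr_natr => /esym; lra.
have q0 : 0 <= q by apply: cos_ge0_pihalf; apply/andP; split; lra.
have qle c : 0 <= c -> c <= pi / 4 -> q <= cos c.
  move=> c0 cpi; rewrite /q leNgt; apply/negP.
  by rewrite ltr_cos ?in_itv /=; [lra | apply/andP; split; lra..].
have [c c_in sE] := @sin_mean_value (x / 2) ltac:(lra).
move: c_in; rewrite in_itv /= => /andP[c0 cx].
have -> : x = (x / 2) *+ 2 by rewrite -mulr_natr; field.
rewrite sin_mulr2n sE -[in leLHS]mulr_natr -[in leRHS]mulr_natr.
apply: le_trans _ (ler_norm _).
have h1 : q <= cos c by apply: qle => //; lra.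
have h2 : q <= cos (x / 2) by apply: qle; lra.
have h3 : 1 / 2 <= cos (x / 2) * cos c.
  by rewrite -q2 expr2 ler_pM.
nra.
Qed.

Lemma normc_cis (t : R) : normc (cis t) = 1.
Proof. by rewrite /= cos2Dsin2 sqrtr1. Qed.

Lemma normc_cis_sub1 (t : R) : normc (cis t - 1) = 2 * `|sin (t / 2)|.
Proof.
have -> : cis t - 1 = (cos t - 1) +i* sin t :> R[i].
  by apply/eqP; rewrite eq_complex /= subr0 !eqxx.
rewrite /normc.
have -> : (cos t - 1) ^+ 2 + sin t ^+ 2 = (2 * sin (t / 2)) ^+ 2.
  have := @cos_mulr2n R (t / 2); have := cos2Dsin2 t; have := cos2Dsin2 (t / 2).
  have -> : (t / 2) *+ 2 = t by rewrite -mulr_natr; field.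
  rewrite -mulr_natr; move: (sin t) (cos t) (sin _) (cos _) => a b c e; nra.
by rewrite sqrtr_sqr normrM ger0_norm.
Qed.

Lemma normc_cis_sub1_le (t : R) : normc (cis t - 1) <= `|t|.
Proof.
rewrite normc_cis_sub1; have := le_norm_sin (t / 2).
rewrite normrM (@ger0_norm _ 2^-1) ?invr_ge0 //; lra.
Qed.

Lemma normc_cis_sub1_ge (t : R) : `|t| <= pi -> `|t| / 2 <= normc (cis t - 1).
Proof.
move=> tpi; rewrite normc_cis_sub1; have := @sin_ge_half (t / 2).
rewrite normrM (@ger0_norm _ 2^-1) ?invr_ge0 //; lra.
Qed.

Variable K : nat.
Hypotheses (K0 : (0 < K)%N) (Ke : ~~ odd K).

Lemma mesh_gt0 : 0 < mesh R K.
Proof. by rewrite /mesh divr_gt0 ?mulr_gt0 ?pi_gt0 ?ltr0n. Qed.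

Lemma mesh_half : mesh R K * (K./2)%:R = pi.
Proof.
have K2 : K%:R = (K./2)%:R * 2 :> R by rewrite -natrM muln2 even_halfK.
have : (K./2)%:R * 2 != 0 :> R by rewrite -K2 pnatr_eq0 -lt0n.
by rewrite /mesh K2 mulf_eq0 negb_or => /andP[h _]; field.
Qed.

(** Passing from the representative in [{0, ..., K - 1}] to the centred one
    changes the angle by a full turn. *)
Lemma chi_crep (x : 'Z_K) : chi R x = cis (mesh R K * (crep x)%:~R).
Proof.
rewrite chi_mesh /crep; case: ifP => _ //.
rewrite -[RHS](cis_turns 1) intrD mulrDr intrN mulrN -addrA.
have -> : mesh R K * K%:~R = pi *+ 2.
  rewrite -mulr_natr -mesh_half -mulrA -natrM muln2 even_halfK //.
by rewrite mulr1n addNr addr0.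
Qed.

Lemma abs_crep (x : 'Z_K) : `|(crep x)%:~R| = `|crep x|%N%:R :> R.
Proof. by rewrite -intr_norm natr_absz. Qed.

Lemma normc_chi (x : 'Z_K) : normc (chi R x) = 1.
Proof. exact: normc_cis. Qed.

Lemma normc_chi_sub1_le (x : 'Z_K) :
  normc (chi R x - 1) <= mesh R K * `|crep x|%N%:R.
Proof.
rewrite chi_crep; apply: le_trans (normc_cis_sub1_le _) _.
by rewrite normrM abs_crep gtr0_norm ?mesh_gt0.
Qed.

(** The centred representative keeps the angle within [[- pi, pi]], where the
    chord is comparable with the arc. *)
Lemma normc_chi_sub1_ge (x : 'Z_K) :
  mesh R K * `|crep x|%N%:R / 2 <= normc (chi R x - 1).
Proof.
rewrite chi_crep; have := @normc_cis_sub1_ge (mesh R K * (crep x)%:~R).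
rewrite normrM abs_crep gtr0_norm ?mesh_gt0 //; apply.
by rewrite -[leRHS]mesh_half ler_pM2l ?mesh_gt0 // ler_nat absz_crep_le.
Qed.

End Characters.

Section DifferenceSymbols.
Variables (R : realType) (d : nat).

Lemma symbol0 k r : symbol k r (fun K => (fun _ _ => 0) : gridmx R d K).
Proof.
have z r' : decay_order r' (fun K => (fun _ _ => 0) : gridmx R d K).
  move=> N; exists 1 => // K K0 Ke m n.
  by rewrite normc0 !mulr_ge0 ?powR_ge0 ?invr_ge0 ?exprn_ge0 ?(ltW (jap_gt0 _ _)).
elim: k r => [|k IH] r; split=> // e.
by apply: eq_symbol (IH _) => K _ _ m n; rewrite /step_diff /mx_shift_diff subrr.
Qed.

(** All differences of a Toeplitz family vanish. *)
Lemma symbol_shift_invariant k r (A : forall K, gridmx R d K) :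
  decay_order r A ->
  (forall K, (0 < K)%N -> ~~ odd K ->
     forall s m n, A K (m + s) (n + s) = A K m n) ->
  symbol k r A.
Proof.
move=> dA invA; case: k => [|k]; split=> // e.
apply: eq_symbol (symbol0 _ _) => K K0 Ke m n.
by rewrite /step_diff /mx_shift_diff invA // subrr.
Qed.

Lemma decay_order_diag r (A : forall K, gridmx R d K) (C : R) : 0 < C ->
  (forall K, (0 < K)%N -> ~~ odd K -> forall m n, m != n -> A K m n = 0) ->
  (forall K, (0 < K)%N -> ~~ odd K -> forall n,
     normc (A K n n) <= C * wt R n n `^ r) ->
  decay_order r A.
Proof.
move=> C0 offA dA N; exists C => // K K0 Ke m n.
have [->|mn] := eqVneq m n; last first.
  rewrite offA // normc0 !mulr_ge0 ?powR_ge0 ?invr_ge0 ?exprn_ge0 ?(ltW C0) //.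
  exact: ltW (jap_gt0 _ _).
have -> : jap R (n - n) = 1.
  rewrite subrr /jap /bracket big1 ?addr0 // => i _.
  by rewrite mxE absz_crep // /=; apply/eqP; rewrite min0n.
by rewrite expr1n invr1 mulr1 dA.
Qed.

Lemma symbol_id k : symbol k 0 (@gmx_id R d).
Proof.
apply: symbol_shift_invariant => [|K _ _ s m n]; last first.
  by rewrite /gmx_id (inj_eq (addIr s)).
apply: (@decay_order_diag _ _ 1) => // K _ _.
  by move=> m n mn; rewrite /gmx_id (negPf mn).
by move=> n; rewrite /gmx_id eqxx normc1 powRr0 mulr1.
Qed.

Definition chi_diag (c : nat -> R[i]) (j : 'I_d) : forall K, gridmx R d K :=
  fun K m n => c K * chi R (n 0 j) * (m == n)%:R.

(** On the grid the weight cannot exceed a multiple of [1 / h], so that powers of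
    [h] count as negative powers of the weight. *)
Lemma wt_mesh_le K (n : grid K d) : (0 < K)%N -> ~~ odd K ->
  wt R n n * mesh R K <= 2 * pi * (1 + d%:R).
Proof.
move=> K0 Ke; have K1 := even_gt1 K0 Ke.
have h0 := mesh_gt0 R K0; have hK := mesh_half R K0 Ke.
have bn : (bracket n)%:R <= d%:R * (K./2)%:R :> R.
  by rewrite -natrM ler_nat bracket_le.
have k1 : 1 <= (K./2)%:R :> R by rewrite ler1n half_gt0.
have d0 : 0 <= d%:R :> R by [].
have p0 : 0 < pi :> R := pi_gt0 R.
have bh : (bracket n)%:R * mesh R K <= d%:R * pi.
  by rewrite -hK (mulrC (mesh R K)) (mulrA d%:R) ler_wpM2r // ltW.
have hpi : mesh R K <= pi by rewrite -hK ler_peMr // ltW.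
rewrite /wt; lra.
Qed.

Lemma normc_chi_unit_sub1_le K (e : bool * 'I_d) (j : 'I_d) :
  (0 < K)%N -> ~~ odd K ->
  normc (chi R (signed_unit K e 0 j) - 1) <= mesh R K.
Proof.
move=> K0 Ke; apply: le_trans (normc_chi_sub1_le R K0 Ke _) _.
rewrite ler_piMr ?(ltW (mesh_gt0 R K0)) // lern1.
have K1 := even_gt1 K0 Ke.
have c01 (b : bool) : (`|crep (b%:R : 'Z_K)| <= 1)%N.
  rewrite absz_crep // val_Zp_nat // modn_small; first by case: b; rewrite geq_min.
  by case: b => //; apply: ltnW.
rewrite /signed_unit; case: e => [[] i] /=; first by rewrite mxE eqxx.
by rewrite !mxE eqxx absz_crepN.
Qed.

(** Differences act on these matrices by multiplying the coefficient by
    [chi s - 1], with [s] in [{0, 1, -1}]; this gains a factor [h], which is one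
    order. *)
Lemma symbol_chi_diag k (p : nat) (C : R) (c : nat -> R[i]) (j : 'I_d) :
  0 < C ->
  (forall K, (0 < K)%N -> ~~ odd K -> normc (c K) <= C * mesh R K ^+ p) ->
  symbol k (- p%:R) (chi_diag c j).
Proof.
have dec p' C' c' : 0 < C' ->
    (forall K, (0 < K)%N -> ~~ odd K -> normc (c' K) <= C' * mesh R K ^+ p') ->
    decay_order (- p'%:R) (chi_diag c' j).
  move=> C0 hc; apply: (@decay_order_diag _ _ (C' * (2 * pi * (1 + d%:R)) ^+ p')).
  - by rewrite mulr_gt0 ?exprn_gt0 ?mulr_gt0 ?pi_gt0 // ltr_pwDl.
  - by move=> K _ _ m n mn; rewrite /chi_diag (negPf mn) mulr0.
  move=> K K0 Ke n; rewrite /chi_diag eqxx mulr1 normcM normc_chi mulr1.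
  apply: le_trans (hc K K0 Ke) _; rewrite -[leRHS]mulrA ler_wpM2l ?(ltW C0) //.
  rewrite powR_invn ?(ltW (wt_gt0 _ _ _)) // ler_pdivlMr ?exprn_gt0 ?wt_gt0 //.
  rewrite -exprMn lerXn2r ?nnegrE //.
  - by rewrite mulr_ge0 ?(ltW (wt_gt0 _ _ _)) ?(ltW (mesh_gt0 R K0)).
  - have := pi_gt0 R; have : 0 <= d%:R :> R by [].
    nra.
  - by rewrite mulrC wt_mesh_le.
elim: k p c => [|k IH] p c C0 hc; split=> //; try exact: dec hc.
move=> e; have -> : - p%:R - 1 = - p.+1%:R :> R by rewrite -opprD natr1.
apply: eq_symbol (IH p.+1 (fun K => c K * (chi R (signed_unit K e 0 j) - 1)) C0 _).
  move=> K K0 Ke m n; rewrite /step_diff /mx_shift_diff /chi_diag.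
  rewrite (inj_eq (addIr _)) mxE chiD ?even_gt1 //; ring.
move=> K K0 Ke; rewrite normcM exprSr mulrA.
by rewrite ler_pM ?normc_ge0 ?hc ?normc_chi_unit_sub1_le //.
Qed.

(** A first difference cancels the constant [-1] of the entry [(chi x - 1) / h];
    what remains is a character with the bounded coefficient
    [(chi (+-1) - 1) / h]. *)
Lemma symbol_Dplus k (j : 'I_d) : symbol k 1 (fun K => @Dmx R d K DPlus j).
Proof.
have dE K : (0 < K)%N -> ~~ odd K -> forall m n : grid K d, Dmx R DPlus j m n =
    (chi R (n 0 j) - 1) / (mesh R K)%:C * (m == n)%:R.
  by move=> K0 Ke m n; rewrite Dmx_plusE ?even_gt1 // chi_mesh.
have dec : decay_order 1 (fun K => @Dmx R d K DPlus j).
  apply: (@decay_order_diag _ _ 1) => // K K0 Ke.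
    by move=> m n mn; rewrite dE // (negPf mn) mulr0.
  move=> n; rewrite dE // eqxx mulr1 mul1r powRr1 ?(ltW (wt_gt0 _ _ _)) //.
  have h0 := mesh_gt0 R K0.
  rewrite normcM normcV normc_real gtr0_norm // ler_pdivrMr //.
  apply: le_trans (normc_chi_sub1_le R K0 Ke _) _.
  rewrite mulrC ler_wpM2r ?(ltW h0) //.
  have := crep_le_bracket n j; rewrite -(ler_nat R) /wt => hj.
  by have : 0 <= (bracket n)%:R :> R by []; lra.
case: k => [|k]; split=> // e.
have -> : 1 - 1 = - (0%:R) :> R by rewrite subrr oppr0.
apply: (@eq_symbol _ _ _ _
  (chi_diag (fun K => (chi R (signed_unit K e 0 j) - 1) / (mesh R K)%:C) j)).
  move=> K K0 Ke m n; rewrite /step_diff /mx_shift_diff !dE // /chi_diag.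
  rewrite (inj_eq (addIr _)) mxE chiD ?even_gt1 //; ring.
apply: (symbol_chi_diag _ _ (C := 1)) => // K K0 Ke.
have h0 := mesh_gt0 R K0.
rewrite expr0 mulr1 normcM normcV normc_real gtr0_norm // ler_pdivrMr // mul1r.
exact: normc_chi_unit_sub1_le.
Qed.

Lemma DminusE K (j : 'I_d) (m n : grid K d) : (1 < K)%N ->
  Dmx R DMinus j m n = - (Dmx R DPlus j m n)^*%C.
Proof.
move=> K1; rewrite Dmx_minusE // Dmx_plusE //.
have -> : cis (- (mesh R K * (n 0 j : nat)%:R))
    = (cis (mesh R K * (n 0 j : nat)%:R))^*%C by rewrite /cis cosN sinN.
have hr : (((mesh R K)%:C)^-1)^*%C = ((mesh R K)%:C)^-1 :> R[i].
  by rewrite -fmorphV conjc_real.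
have [_|_] := eqVneq m n; last by rewrite !mulr0 conjc0 oppr0.
have conjM (x y : R[i]) : (x * y)^*%C = x^*%C * y^*%C by exact: rmorphM.
have conjB (x y : R[i]) : (x - y)^*%C = x^*%C - y^*%C by exact: rmorphB.
by rewrite !mulr1 conjM hr conjB conjc1 -mulNr opprB.
Qed.

Lemma symbol_Dmx k (e : dsign) (j : 'I_d) :
  symbol k (dsign_abs e)%:R (fun K => @Dmx R d K e j).
Proof.
case: e => /=; [exact: symbol_id | exact: symbol_Dplus |].
apply: eq_symbol (@symbol_map _ _ (fun z => - z^*%C) _ _ _ _ _ (symbol_Dplus k j)).
- by move=> K K0 Ke m n; apply/esym/DminusE/even_gt1.
- by move=> x y; rewrite -opprD; congr (- _); exact: rmorphB.
- by move=> [a b]; rewrite normcN /= sqrrN.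
Qed.

End DifferenceSymbols.

(** * Difference quotients of smooth periodic functions *)

Section DifferenceQuotients.
Variables (R : realType) (d : nat).
Implicit Types (f : 'rV[R]_d -> R) (v x c : 'rV[R]_d).

Definition diffq (h : R) v f : 'rV[R]_d -> R :=
  fun x => (f (x + h *: v) - f x) / h.

Lemma is_derive_translate f x v c (df : R) :
  is_derive (x + c) v f df -> is_derive x v (fun y => f (y + c)) df.
Proof.
have E : (fun h : R => h^-1 *: (((fun y => f (y + c)) \o shift x) (h *: v) - f (x + c)))
    = (fun h : R => h^-1 *: ((f \o shift (x + c)) (h *: v) - f (x + c))).
  by apply/funext => h /=; rewrite addrA.
move=> [exd <-]; split; rewrite /derivable /derive ?E //.
Qed.

Lemma is_derive_line f x v (t df : R) :
  is_derive (x + t *: v) v f df -> is_derive t 1 (fun s : R => f (x + s *: v)) df.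
Proof.
have E : (fun h : R => h^-1 *: (((fun s => f (x + s *: v)) \o shift t) (h *: 1)
      - f (x + t *: v)))
    = (fun h : R => h^-1 *: ((f \o shift (x + t *: v)) (h *: v) - f (x + t *: v))).
  apply/funext => h /=; congr (_ *: (f _ - _)).
  by rewrite scalerDl [h *: 1]mulr1 addrCA.
move=> [exd <-]; split; rewrite /derivable /derive ?E //.
Qed.

Lemma is_derive_diffq f f' (h : R) v x :
  (forall y, is_derive y v f (f' y)) ->
  is_derive x v (diffq h v f) (diffq h v f' x).
Proof.
move=> df; have df1 := is_derive_translate (df (x + h *: v)).
have := is_deriveZ h^-1 (is_deriveB df1 (df x)).
rewrite /diffq => H; apply: (is_derive_eq (f' := h^-1 *: (f' (x + h *: v) - f' x))).
  have -> : (fun y => (f (y + h *: v) - f y) / h) =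
    h^-1 \*: ((fun y => f (y + h *: v)) - f) by apply/funext => y; rewrite mulrC.
  exact: H.
by rewrite mulrC.
Qed.

Lemma diffq_mean_value f f' (h : R) v x B : 0 < h ->
  (forall y, is_derive y v f (f' y)) -> (forall y, `|f' y| <= B) ->
  `|diffq h v f x| <= B.
Proof.
move=> h0 df fB.
have dg (t : R) : is_derive t 1 (fun s : R => f (x + s *: v)) (f' (x + t *: v)).
  exact: is_derive_line.
have [|c _] := MVT_segment (ltW h0) (fun t _ => dg t).
  apply: derivable_within_continuous => t _; by have [] := dg t.
rewrite scale0r addr0 subr0 => E.
by rewrite /diffq E mulfK ?gt_eqF.
Qed.

(** [F] lists the successive derivatives.  A difference quotient commutes with the
    derivative, so the induction differentiates and takes quotients in turn: the
    list of quotients is one shorter, and its last entry is controlled by the mean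
    value theorem. *)
Lemma iter_diffq_le (n : nat) (F : nat -> 'rV[R]_d -> R) (h : R) v x B : 0 < h ->
  (forall i y, is_derive y v (F i) (F i.+1 y)) -> (forall y, `|F n y| <= B) ->
  `|iter n (diffq h v) (F 0) x| <= B.
Proof.
move=> h0; elim: n F x B => [|n IH] F x B dF FB; first exact: FB.
rewrite iterSr; apply: (IH (fun i => diffq h v (F i))).
  by move=> i y; apply: is_derive_diffq.
by move=> y; apply: diffq_mean_value FB.
Qed.

End DifferenceQuotients.

Section PeriodicFunctions.
Variables (R : realType) (d : nat).
Implicit Types (f : 'rV[R]_d -> R).

Definition multi_periodic (T : Type) (f : 'rV[R]_d -> T) :=
  forall (j : 'I_d) x, f (x + (2 * pi) *: unit_vec R j) = f x.

Lemma multi_periodic_int (T : Type) (f : 'rV[R]_d -> T) (z : 'I_d -> int) x :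
  multi_periodic f ->
  f (x + \sum_j ((z j)%:~R * (2 * pi)) *: unit_vec R j) = f x.
Proof.
move=> pf.
have pfn j n y : f (y + (n%:R * (2 * pi)) *: unit_vec R j) = f y.
  elim: n y => [|n IH] y; first by rewrite mul0r scale0r addr0.
  by rewrite -natr1 mulrDl mul1r scalerDl addrA pf IH.
have pfz j k y : f (y + (k%:~R * (2 * pi)) *: unit_vec R j) = f y.
  case: (intP k) => [|n|n]; first by rewrite mul0r scale0r addr0.
    exact: (pfn j n.+1).
  by rewrite -[LHS](pfn j n.+1) rmorphN /= mulNr scaleNr addrNK.
elim: (index_enum _) x => [|j s IH] x; first by rewrite big_nil addr0.
by rewrite big_cons addrA IH pfz.
Qed.

(** Every value is taken on the compact cube [[0, 2 pi] ^ d]. *)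
Lemma multi_periodic_bounded f : continuous f -> multi_periodic f ->
  exists2 B, 0 < B & forall x, `|f x| <= B.
Proof.
move=> cf pf.
have pi2 : 0 < 2 * pi :> R by rewrite mulr_gt0 ?pi_gt0.
pose A := [set v : 'rV[R]_d | forall i, `[0 : R, 2 * pi]%classic (v ord0 i)]%classic.
have cA : compact A.
  apply: (@rV_compact R d (fun=> `[0, 2 * pi]%classic)) => _.
  exact: segment_compact.
have A0 : (A !=set0)%classic.
  by exists 0 => i /=; rewrite mxE in_itv /= lexx ltW.
have [u _ hu] := EVT_max_rV A0 cA (continuous_subspaceT cf).
have [l _ hl] := EVT_min_rV A0 cA (continuous_subspaceT cf).
exists (`|f u| + `|f l| + 1) => [|x]; first by rewrite ltr_pwDr ?addr_ge0.
pose z (i : 'I_d) := - Num.floor (x 0 i / (2 * pi)).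
rewrite -(multi_periodic_int z x pf); set y := x + _.
have yA : y \in A.
  rewrite inE => i /=; rewrite in_itv /= /y mxE summxE (bigD1 i) //= big1.
    rewrite !mxE !eqxx mulr1 addr0 /z rmorphN /= mulNr.
    set t := x 0 i / (2 * pi).
    have -> : x ord0 i = t * (2 * pi) by rewrite /t divfK ?gt_eqF.
    have /andP[fl1 fl2] := floor_itv t.
    rewrite -mulrBl.
    rewrite mulr_ge0 ?subr_ge0 ?(ltW pi2) //=.
    rewrite ler_piMl ?(ltW pi2) // lerBlDl ltW //.
    by move: fl2; rewrite intrD.
  by move=> k ki; rewrite !mxE (eq_sym i) (negPf ki) andbF mulr0.
have := hu _ yA; have := hl _ yA.
have := ler_norm (f u); have := ler_norm (- f l); rewrite normrN.
have := normr_ge0 (f u); have := normr_ge0 (f l); rewrite ler_norml; lra.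
Qed.

Lemma multi_periodic_derive f v : multi_periodic f -> multi_periodic ('D_v f).
Proof.
move=> pf j x; rewrite /derive.
have -> // : (fun h : R => h^-1 *: ((f \o shift (x + (2 * pi) *: unit_vec R j))
      (h *: v) - f (x + (2 * pi) *: unit_vec R j)))
    = (fun h : R => h^-1 *: ((f \o shift x) (h *: v) - f x)).
by apply/funext => h /=; rewrite addrA !pf.
Qed.

Lemma smooth_partial_bounded f (s : seq 'I_d) : smooth f -> multi_periodic f ->
  exists2 B, 0 < B & forall x, `|iter_partial s f x| <= B.
Proof.
move=> sf pf; apply: multi_periodic_bounded; first by have [] := sf s.
by elim: s => [|j s IH] //; apply: multi_periodic_derive.
Qed.

Lemma smooth_iter_diffq_bounded f (j : 'I_d) (n : nat) :
  smooth f -> multi_periodic f ->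
  exists2 B, 0 < B & forall (h : R) x, 0 < h ->
    `|iter n (diffq h (unit_vec R j)) f x| <= B.
Proof.
move=> sf pf; have [B B0 hB] := smooth_partial_bounded (nseq n j) sf pf.
exists B => // h x h0.
apply: (@iter_diffq_le _ _ n (fun i => iter_partial (nseq i j) f)) => // i y.
by apply: derivableP; have [_] := sf (nseq i j).
Qed.

End PeriodicFunctions.

(** * Multiplication operators *)

Section FourierDecay.
Variables (R : realType) (d : nat).

Definition cdiffq (h : R) (v : 'rV[R]_d) (V : 'rV[R]_d -> R[i]) : 'rV[R]_d -> R[i] :=
  fun x => (V (x + h *: v) - V x) / h%:C.

Lemma divc_real (z : R[i]) (h : R) :
  z / h%:C = (complex.Re z / h) +i* (complex.Im z / h).
Proof.
rewrite -fmorphV; case: z => a b; apply/eqP.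
by rewrite eq_complex /= !mulr0 subr0 add0r !eqxx.
Qed.

Lemma iter_cdiffq (n : nat) h v V x :
  iter n (cdiffq h v) V x =
  (iter n (diffq h v) (fun y => complex.Re (V y)) x) +i*
  (iter n (diffq h v) (fun y => complex.Im (V y)) x).
Proof.
elim: n x => [|n IH] x /=; first by case: (V x).
by rewrite {1}/cdiffq !IH divc_real.
Qed.

Lemma normc_le_ReIm (a b : R) : normc (a +i* b) <= `|a| + `|b|.
Proof.
rewrite /normc -(ler_pXn2r (ltn0Sn 1)) ?nnegrE ?sqrtr_ge0 ?addr_ge0 //.
rewrite sqr_sqrtr ?addr_ge0 ?sqr_ge0 // sqrrD !real_normK ?num_real //.
by rewrite addrAC lerDl mulrn_wge0 ?mulr_ge0.
Qed.

Lemma torus_iter_cdiffq_bounded V (j : 'I_d) (n : nat) : smooth_on_torus V ->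
  exists2 B, 0 < B & forall (h : R) x, 0 < h ->
    normc (iter n (cdiffq h (unit_vec R j)) V x) <= B.
Proof.
move=> [pV sRe sIm].
have [B B0 hB] := @smooth_iter_diffq_bounded _ _ (fun y => complex.Re (V y)) j n sRe
  (fun i x => congr1 (@complex.Re R) (pV i x)).
have [C C0 hC] := @smooth_iter_diffq_bounded _ _ (fun y => complex.Im (V y)) j n sIm
  (fun i x => congr1 (@complex.Im R) (pV i x)).
exists (B + C) => [|h x h0]; first exact: addr_gt0.
rewrite iter_cdiffq; apply: le_trans (normc_le_ReIm _ _) _.
by rewrite lerD ?hB ?hC.
Qed.

Section Grid.
Variable K : nat.
Hypotheses (K0 : (0 < K)%N) (Ke : ~~ odd K).
Let K1 := even_gt1 K0 Ke.

(** Addition wraps around on the grid, hence the correction by a multiple of the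
    period. *)
Lemma grid_point_shift (a : grid K d) (j : 'I_d) :
  exists z : 'I_d -> int,
    grid_point R (a + unit_vec _ j) + \sum_i ((z i)%:~R * (2 * pi)) *: unit_vec R i
    = grid_point R a + mesh R K *: unit_vec R j.
Proof.
have K0' : K%:R != 0 :> R by rewrite pnatr_eq0 -lt0n.
exists (fun i => if i == j then ((a 0%R i + 1) %/ K)%N%:Z else 0).
apply/rowP => i; rewrite !mxE summxE (bigD1 i) //= [\sum_(_ | _) _]big1; last first.
  by move=> k ki; rewrite !mxE (eq_sym i) (negPf ki) andbF mulr0.
rewrite !mxE !eqxx /= mulr1 addr0; have [->|ij] := eqVneq i j; last first.
  rewrite mulr0 mul0r !addr0 [X in (_ %% X)%N]Zp_cast // [X in (_ + X)%N](_ : _ = 0%N) //.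
  by rewrite addn0 modn_small ?ltn_Zp.
rewrite [X in (_ %% X)%N]Zp_cast // [X in (_ + X)%N](_ : _ = 1%N); last first.
  by rewrite -[RHS](@modn_small 1 K) // -val_Zp_nat.
set n := nat_of_ord (a 0 j).
have -> : (((n + 1) %/ K)%N%:Z)%:~R * (2 * pi) = ((n + 1) %/ K * K)%N%:R * mesh R K.
  by rewrite -pmulrn natrM /mesh; field.
by rewrite -mulrDl -natrD addnC -divn_eq natrD mulrDl mul1r mulr1.
Qed.

Lemma delta_sample (V : 'rV[R]_d -> R[i]) (j : 'I_d) : multi_periodic V ->
  delta_op DPlus j (fun a : grid K d => V (grid_point R a)) =
  (fun a => cdiffq (mesh R K) (unit_vec R j) V (grid_point R a)).
Proof.
move=> pV; apply/funext => a; rewrite /delta_op /cdiffq.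
by have [z <-] := grid_point_shift a j; rewrite multi_periodic_int.
Qed.

Lemma cdiffq_periodic h v V : multi_periodic V -> multi_periodic (cdiffq h v V).
Proof. by move=> pV j x; rewrite /cdiffq addrAC !pV. Qed.

Lemma iter_delta_sample (n : nat) (V : 'rV[R]_d -> R[i]) (j : 'I_d) :
  multi_periodic V ->
  iter n (delta_op DPlus j) (fun a : grid K d => V (grid_point R a)) =
  (fun a => iter n (cdiffq (mesh R K) (unit_vec R j)) V (grid_point R a)).
Proof.
elim: n V => [//|n IH] V pV; rewrite !iterSr delta_sample //.
exact/IH/cdiffq_periodic.
Qed.

(** Summation by parts moves the shift of [v] onto the exponential, where it acts
    as the multiplication by [chi a_j]. *)
Lemma dft_delta (v : grid K d -> R[i]) (j : 'I_d) (a : grid K d) :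
  dft (delta_op DPlus j v) a = (chi R (a 0 j) - 1) / (mesh R K)%:C * dft v a.
Proof.
rewrite /dft /delta_op [RHS]mulrCA; congr (_ * _).
under eq_bigr => b _ do rewrite mulrA mulrBr mulrBl.
rewrite sumrB -!mulr_suml -mulrBl [RHS]mulrAC; congr (_ / _).
rewrite mulrBl mul1r; congr (_ - _); rewrite mulr_sumr.
rewrite (reindex_inj (addIr (- unit_vec _ j))); apply: eq_bigr => b _ /=.
rewrite subrK dotpDr dotpNr dotp_basis opprD opprK chiD //; ring.
Qed.

Lemma dft_iter_delta (n : nat) (v : grid K d -> R[i]) (j : 'I_d) (a : grid K d) :
  dft (iter n (delta_op DPlus j) v) a
  = ((chi R (a 0 j) - 1) / (mesh R K)%:C) ^+ n * dft v a.
Proof.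
elim: n => [|n IH]; first by rewrite mul1r.
by rewrite iterS dft_delta IH exprS mulrA.
Qed.

Lemma normc_dft_le (v : grid K d -> R[i]) (a : grid K d) (B : R) :
  (forall b, normc (v b) <= B) -> normc (dft v a) <= B.
Proof.
move=> vB.
have Kd0 : 0 < (K%:R : R) ^+ d by rewrite exprn_gt0 ?ltr0n.
rewrite /dft normcM normcV.
have -> : (K%:R : R[i]) ^+ d = ((K%:R : R) ^+ d)%:C by rewrite rmorphXn rmorph_nat.
rewrite normc_real gtr0_norm // mulrC ler_pdivrMr // mulrC.
apply: le_trans (normc_sum _) _.
rewrite -natrX -(card_grid d K1) -sumr_const mulr_suml.
by apply: ler_sum => b _; rewrite normcM normc_chi !mul1r.
Qed.

Lemma normcX (z : R[i]) n : normc (z ^+ n) = normc z ^+ n.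
Proof. by elim: n => [|n IH]; rewrite ?normc1 // !exprS normcM IH. Qed.

Lemma dft_decay_coord (v : grid K d -> R[i]) (j : 'I_d) (n : nat) (B : R)
    (a : grid K d) :
  (forall b, normc (iter n (delta_op DPlus j) v b) <= B) ->
  (`|crep (a 0%R j)|%N%:R / 2) ^+ n * normc (dft v a) <= B.
Proof.
move=> vB; apply: le_trans (normc_dft_le a vB).
rewrite dft_iter_delta; move: (dft v a) => w.
rewrite normcM normcX ler_wpM2r ?normc_ge0 //.
have h0 := mesh_gt0 R K0.
rewrite lerXn2r ?nnegrE ?divr_ge0 ?normc_ge0 //.
rewrite normcM normcV normc_real gtr0_norm // ler_pdivlMr //.
by rewrite mulrC mulrA normc_chi_sub1_ge.
Qed.

End Grid.

(** At a frequency [a], the coordinate [j] of largest absolute value [x] satisfies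
    [1 + [a] <= 1 + d x]; [N] summations by parts in that direction give a gain
    of [(x / 2) ^ N].  When [x = 0] there is no gain, but [a = 0] and the sup bound
    suffices. *)
Lemma dft_sample_decay (V : 'rV[R]_d -> R[i]) (N : nat) : (0 < d)%N ->
  smooth_on_torus V ->
  exists2 C, 0 < C & forall K, (0 < K)%N -> ~~ odd K -> forall a : grid K d,
    normc (dft (fun b => V (grid_point R b)) a) <= C * jap R a ^- N.
Proof.
move=> d0 sV; have pV : multi_periodic V by have [] := sV.
have [B0 B0gt hB0] := torus_iter_cdiffq_bounded (Ordinal d0) 0 sV.
have /choice[B hB] : forall j : 'I_d, exists B, 0 < B /\
    forall (h : R) x, 0 < h ->
      normc (iter N (cdiffq h (unit_vec R j)) V x) <= B.
  by move=> j; have [B ? ?] := torus_iter_cdiffq_bounded j N sV; exists B.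
pose L : R := 2 * (1 + d%:R).
have L0 : 0 < L by rewrite mulr_gt0 // ltr_pwDl.
have SB0 : 0 <= \sum_j B j by apply: sumr_ge0 => j _; case: (hB j) => /ltW.
exists (B0 + L ^+ N * \sum_j B j) => [|K K0 Ke a].
  by rewrite ltr_pwDl // mulr_ge0 ?exprn_ge0 // ltW.
rewrite ler_pdivlMr ?exprn_gt0 ?jap_gt0 //.
set w := normc _; have w0 : 0 <= w by apply: normc_ge0.
have [j hj] := bracket_max a d0.
set x := `|crep (a 0%R j)|%N in hj.
have hja : jap R a <= 1 + d%:R * x%:R by rewrite /jap lerD2l -natrM ler_nat.
have [x0|x0] := posnP x.
  have j1 : jap R a = 1.
    by apply/eqP; rewrite eq_le jap_ge1 andbT; move: hja; rewrite x0 mulr0 addr0.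
  rewrite j1 expr1n mulr1.
  apply: (@le_trans _ _ B0); last by rewrite lerDl mulr_ge0 ?exprn_ge0 // ltW.
  by apply: normc_dft_le => // b; apply: (hB0 1).
have hN : (x%:R / 2) ^+ N * w <= B j.
  apply: dft_decay_coord => // b; rewrite iter_delta_sample //.
  by have [_] := hB j; apply; apply: mesh_gt0.
have hx : jap R a <= L * (x%:R / 2).
  apply: le_trans hja _; rewrite /L.
  have : 1 <= x%:R :> R by rewrite ler1n.
  lra.
apply: (@le_trans _ _ (L ^+ N * B j)); last first.
  rewrite (bigD1 j) //= -[leLHS]add0r lerD ?(ltW B0gt) //.
  rewrite ler_wpM2l ?exprn_ge0 ?(ltW L0) // lerDl.
  by apply: sumr_ge0 => i _; case: (hB i) => /ltW.
apply: (@le_trans _ _ (w * (L * (x%:R / 2)) ^+ N)).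
  rewrite ler_wpM2l // lerXn2r ?nnegrE ?(ltW (jap_gt0 _ _)) //.
  by rewrite mulr_ge0 ?(ltW L0) ?divr_ge0.
rewrite exprMn mulrCA ler_wpM2l ?exprn_ge0 ?(ltW L0) // mulrC //.
Qed.

Lemma MmxE K (V : 'rV[R]_d -> R[i]) (m n : grid K d) : (1 < K)%N ->
  Mmx V m n = dft (fun b => V (grid_point R b)) (m - n).
Proof.
move=> K1; rewrite /Mmx /fourier_mx /dft; congr (_ * _).
apply: eq_bigr => b _; rewrite /mult_op idft_delta // mulrCA [LHS]mulrC; congr (_ * _).
by rewrite -chiD // (dotpC (m - n)) dotpDr dotpNr opprD opprK (dotpC m).
Qed.

Lemma symbol_Mmx k (V : 'rV[R]_d -> R[i]) : (0 < d)%N -> smooth_on_torus V ->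
  symbol k 0 (fun K => Mmx V : gridmx R d K).
Proof.
move=> d0 sV; apply: symbol_shift_invariant => [N|K K0 Ke s m n]; last first.
  by rewrite !MmxE ?even_gt1 // opprD addrACA subrr addr0.
have [C C0 hC] := dft_sample_decay N d0 sV.
exists C => // K K0 Ke m n; rewrite MmxE ?even_gt1 // powRr0 mulr1; exact: hC.
Qed.

End FourierDecay.

(** * Conjugation by the Fourier transform *)

Section Conjugation.
Variables (R : realType) (d K : nat).
Hypothesis K1 : (1 < K)%N.
Implicit Types (u v : grid K d -> R[i]) (T : (grid K d -> R[i]) -> grid K d -> R[i]).

Definition represents T (A : gridmx R d K) :=
  forall u a, dft (T u) a = gmx_apply A (dft u) a.

Lemma represents_id : represents id (@gmx_id R d K).
Proof. by move=> u a; rewrite /gmx_apply sum_delta. Qed.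

Lemma represents_comp S T A B : represents S A -> represents T B ->
  represents (S \o T) (gmx_mul A B).
Proof.
move=> SA TB u a; rewrite /= SA /gmx_apply /gmx_mul.
under eq_bigr => b _ do rewrite TB /gmx_apply mulr_sumr.
rewrite exchange_big /=; apply: eq_bigr => c _; rewrite mulr_suml.
by apply: eq_bigr => b _; rewrite mulrA.
Qed.

(** Fourier inversion expands [u] in the basis of exponentials; linearity of [T]
    does the rest. *)
Lemma represents_fourier_mx T :
  (forall (c : grid K d -> R[i]) (w : grid K d -> grid K d -> R[i]),
     T (fun a => \sum_n c n * w n a) = (fun a => \sum_n c n * T (w n) a)) ->
  represents T (fourier_mx T).
Proof.
move=> linT u a.
have uE : u = (fun b => \sum_n dft u n * idft (fun k => (k == n)%:R) b).
  apply/funext => b; rewrite -[LHS]dftK // {1}/idft; apply: eq_bigr => n _.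
  by rewrite idft_delta // mulrC.
rewrite {1}uE linT /gmx_apply /fourier_mx /dft.
under eq_bigr => b _ do rewrite mulr_sumr.
rewrite exchange_big mulr_sumr /=; apply: eq_bigr => n _.
rewrite -mulrA [in RHS]mulr_suml; congr (_ * _); apply: eq_bigr => b _.
by rewrite [in RHS]mulrAC mulrA.
Qed.

Lemma represents_mult_op (V : 'rV[R]_d -> R[i]) : represents (mult_op V) (Mmx V).
Proof.
apply: represents_fourier_mx => c w; apply/funext => a; rewrite /mult_op mulr_sumr.
by apply: eq_bigr => n _; rewrite mulrCA.
Qed.

Lemma represents_delta_op (e : dsign) (j : 'I_d) :
  represents (delta_op e j) (Dmx R e j).
Proof.
case: e; first exact: represents_id.
all: apply: represents_fourier_mx => c w; apply/funext => a; rewrite /delta_op.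
all: rewrite -sumrB mulr_suml; apply: eq_bigr => n _.
all: by rewrite -mulrBr mulrA.
Qed.

End Conjugation.

(** * From iterated differences to the periodic classes *)

Section Classes.
Variables (R : realType) (d : nat).

Lemma symbol_mx_diff1 (r : R) (j : 'I_d) (a : int) (A : forall K, gridmx R d K) :
  (forall k, symbol k r A) ->
  forall k, symbol k (r - `|a|%N%:R) (fun K => mx_diff1 j a (A K)).
Proof.
move=> sA.
have steps (e : bool * 'I_d) (n : nat) : forall k, symbol k (r - n%:R)
    (fun K => iter n (mx_shift_diff (signed_unit K e)) (A K)).
  elim: n => [|n IH] k; first by rewrite subr0.
  have [_ /(_ e)] := IH k.+1.
  by rewrite -natr1 opprD addrA.
case: a => n k; [exact: (steps (true, j)) | exact: (steps (false, j) n.+1)].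
Qed.

Lemma symbol_mx_diff (r : R) (alpha : 'I_d -> int) (A : forall K, gridmx R d K) :
  (forall k, symbol k r A) ->
  forall k, symbol k (r - (normi alpha)%:R) (fun K => mx_diff alpha (A K)).
Proof.
rewrite /mx_diff /normi => sA.
elim: (index_enum _) => [|j s IH] k.
  rewrite big_nil subr0; apply: eq_symbol (sA k) => K _ _ m n.
  by rewrite big_nil.
rewrite big_cons addnC natrD opprD addrA.
apply: eq_symbol (symbol_mx_diff1 j (alpha j) IH k) => K _ _ m n.
by rewrite big_cons.
Qed.

(** A mixed difference of multi-index [alpha] is one particular sequence of
    elementary differences. *)
Lemma symbol_Aper (r : R) (A : forall K, gridmx R d K) :
  (forall k, symbol k r A) -> Aper r A.
Proof.
move=> sA alpha N.
have [C C0 hC] := symbol_decay (symbol_mx_diff alpha sA 0) N.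
by exists C; split=> // K K0 Ke m n; rewrite normCE lecR; apply: hC.
Qed.

End Classes.

Theorem corollary3p9 (R : realType) (d : nat) (hd : (1 <= d)%N) (P : nat)
    (V : 'I_P -> 'rV[R]_d -> R[i]) (hV : forall p, smooth_on_torus (V p))
    (eps : 'I_P -> dsign) (j : 'I_P -> 'I_d)
    (A : forall K : nat, gridmx R d K)
    (hA : forall K : nat, (0 < K)%N -> ~~ odd K ->
      A K = \big[@gmx_mul R d K/@gmx_id R d K]_(p < P)
              gmx_mul (Mmx (V p)) (Dmx R (eps p) (j p))) :
  (forall K : nat, (0 < K)%N -> ~~ odd K ->
     forall (u : grid K d -> R[i]) (a : grid K d),
       dft ((\big[(fun f g => f \o g)/id]_(p < P)
               (mult_op (V p) \o delta_op (eps p) (j p))) u) a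
       = gmx_apply (A K) (dft u) a) /\
  Aper (\sum_(p < P) dsign_abs (eps p))%:R A.
Proof.
split=> [K K0 Ke|].
  have K1 := even_gt1 K0 Ke; rewrite hA //.
  apply: (big_rec2 (fun T B => represents T B)); first exact: represents_id.
  move=> p T B _ TB; apply: represents_comp => //.
  by apply: represents_comp; [exact: represents_mult_op|exact: represents_delta_op].
apply: symbol_Aper => k.
apply: (@eq_symbol _ _ _ _ (fun K => \big[@gmx_mul R d K/@gmx_id R d K]_(p < P)
              gmx_mul (Mmx (V p)) (Dmx R (eps p) (j p)))).
  by move=> K K0 Ke m n; rewrite hA.
elim: (index_enum _) => [|p s IH].
  rewrite big_nil; apply: eq_symbol (symbol_id R d k) => K _ _ m n.
  by rewrite big_nil.
rewrite big_cons natrD.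
have sMD := symbol_mul (symbol_Mmx k hd (hV p)) (symbol_Dmx R k (eps p) (j p)).
rewrite add0r in sMD.
apply: eq_symbol (symbol_mul sMD IH) => K _ _ m n.
by rewrite big_cons.
Qed.
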